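(* Let $G=(V,E)$ be a locally finite graph and let $\Omega\cup\partial\Omega\subset V$ be a bounded domain with $\Omega\neq\emptyset$ and $\partial\Omega\neq\emptyset$. Let $m_1,m_2$ be positive integers, $p,q,\gamma_1,\gamma_2>1$, $\lambda_1,\lambda_2,\alpha,\beta>0$ with $\max\{\gamma_1,\gamma_2\}<\min\{p,q\}\le\max\{p,q\}<\alpha+\beta$, and let $h_1,h_2,c:\Omega\to\mathbb{R}^+=(0,+\infty)$. Consider the system $$\begin{cases}\pounds_{m_1,p}u=\lambda_1h_1(x)|u|^{\gamma_1-2}u+\frac{\alpha}{\alpha+\beta}c(x)|u|^{\alpha-2}u|v|^{\beta},&x\in\Omega,\\ \pounds_{m_2,q}v=\lambda_2h_2(x)|v|^{\gamma_2-2}v+\frac{\beta}{\alpha+\beta}c(x)|u|^{\alpha}|v|^{\beta-2}v,&x\in\Omega,\\ u=v=0,&x\in\partial\Omega.\end{cases}$$ For each $\lambda_1>0$, if $(u,v)$ is a semi-trivial solution of the system with $(u,v)=(u,0)$, then $$\|u\|_{W_0^{m_1,p}(\Omega)}\le\left(\lambda_1H_1C_{m_1,p}^{\gamma_1}(\Omega)\right)^{\frac1{p-\gamma_1}},\qquad H_1=\max_{x\in\Omega}h_1(x).$$ Similarly, for each $\lambda_2>0$, if $(u,v)$ is a semi-trivial solution of the system with $(u,v)=(0,v)$, then $$\|v\|_{W_0^{m_2,q}(\Omega)}\le\left(\lambda_2H_2C_{m_2,q}^{\gamma_2}(\Omega)\right)^{\frac1{q-\gamma_2}},\qquad H_2=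\max_{x\in\Omega}h_2(x).$$
   Context: Graph setting. $G=(V,E)$ is a graph with vertex set $V$ and edge set $E$; it is locally finite if every vertex lies on only finitely many edges. $y\sim x$ means $xy\in E$. Each edge has a weight $\omega_{xy}=\omega_{yx}>0$. $\mu:V\to(0,+\infty)$ is a (finite-valued) measure with $\mu(x)\ge\mu_0>0$ for all $x$. $\int_A f\,d\mu=\sum_{x\in A}f(x)\mu(x)$. $d(x,y)$ is the minimal number of edges connecting $x$ and $y$; a set of vertices is a bounded domain if $d(x,y)$ is uniformly bounded for $x,y$ in it. $\partial\Omega=\{y\in V\setminus\Omega:\exists x\in\Omega,\ xy\in E\}$. Operators, for $u,u_1,u_2:V\to\mathbb{R}$: $\Delta u(x)=\frac1{\mu(x)}\sum_{y\sim x}\omega_{xy}(u(y)-u(x))$; $\Gamma(u_1,u_2)(x)=\frac{1}{2\mu(x)}\sum_{y\sim x}\omega_{xy}(u_1(y)-u_1(x))(u_2(y)-u_2(x))$; $|\nabla u|=\sqrt{\Gamma(u,u)}$; $|\nabla^mu|=|\nabla\Delta^{\frac{m-1}2}u|$ if $m$ is odd and $|\nabla^mu|=|\Delta^{\frac m2}u|$ if $m$ is even. Spaces. $C_c(\Omega)=\{u:V\to\mathbb{R}: u=0 \text{ on } V\setminus\Omega\}$. $\|u\|_{L^r(\Omega)}=(\int_\Omega|u|^rd\mu)^{1/r}$ for $1\le r<\infty$, $\|u\|_\infty=\max_\Omega|u|$. $W_0^{m,s}(\Omega)$ ($m\ge1$ integer, $s>1$) is the completion of $C_c(\Omega)$ under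 $\|u\|_{W_0^{m,s}(\Omega)}=(\int_{\Omega\cup\partial\Omega}|\nabla^mu|^sd\mu)^{1/s}$; it is finite-dimensional. $W=W_0^{m_1,p}(\Omega)\times W_0^{m_2,q}(\Omega)$. Embedding constants. $C_{m,s}(\Omega)>0$ is a fixed constant depending only on $m,s,\Omega$ such that $\|u\|_{L^r(\Omega)}\le C_{m,s}(\Omega)\|u\|_{W_0^{m,s}(\Omega)}$ for all $u\in W_0^{m,s}(\Omega)$ and all $1\le r\le+\infty$ (such constants exist). The operator $\pounds_{m,s}$ is defined by: for every $\phi\in C_c(\Omega)$, $\int_\Omega(\pounds_{m,s}u)\phi\,d\mu$ equals $\int_{\Omega\cup\partial\Omega}|\nabla^mu|^{s-2}\Gamma(\Delta^{\frac{m-1}2}u,\Delta^{\frac{m-1}2}\phi)\,d\mu$ if $m$ is odd and $\int_{\Omega\cup\partial\Omega}|\nabla^mu|^{s-2}\Delta^{\frac m2}u\,\Delta^{\frac m2}\phi\,d\mu$ if $m$ is even. Convention: $|t|^{a-2}t$ is taken to be $0$ at $t=0$, and likewise the integrands defining $\pounds_{m,s}$ are $0$ where $|\nabla^m u|=0$. A solution is a pair $(u,v)\in W$ satisfying the system at every point. A semi-trivial solution is a solution of the form $(u,0)$ or $(0,v)$. *)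

(* Defs.v *)
From mathcomp Require Import all_boot all_order all_algebra.
From mathcomp Require Import all_classical all_reals all_analysis.
Set Implicit Arguments.
Unset Strict Implicit.
Unset Printing Implicit Defensive.
Import Order.TTheory GRing.Theory Num.Theory.
Import numFieldNormedType.Exports.
Local Open Scope classical_set_scope.
Local Open Scope ring_scope.

(* Loops are not excluded: a loop contributes 0 to every operator below. *)
Record wgraph (R : realType) := WGraph {
  vertex :> choiceType;
  adj : rel vertex;
  adj_sym : symmetric adj;
  weight : vertex -> vertex -> R;
  weight_sym : forall x y, adj x y -> weight x y = weight y x;
  weight_gt0 : forall x y, adj x y -> 0 < weight x y;
  vmeas : vertex -> R;
  vmeas_ge : exists2 mu0, 0 < mu0 & forall x, mu0 <= vmeas x
}.

Section Graph.
Variables (R : realType) (G : wgraph R).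
Implicit Types (x y : G) (u v w f phi : G -> R) (A Omega : set G).
Implicit Types (m : nat) (s r C : R).

Definition nbhd x : set G := [set y | adj x y].

Definition locally_finite := forall x, finite_set (nbhd x).

(* Number of edges of a shortest walk; +oo if there is none. *)
Definition gdist x y : \bar R :=
  ereal_inf [set (size t)%:R%:E | t in [set t | path (@adj _ G) x t /\ last x t = y]].

Definition bounded_domain A :=
  exists D : R, forall x y, A x -> A y -> (gdist x y <= D%:E)%E.

Definition bdry Omega : set G :=
  [set y | ~ Omega y /\ exists2 x, Omega x & adj x y].

(* The sum over A is the finitely supported sum of the library: it is the
   usual sum when A is finite, which holds for bounded domains of locally
   finite graphs. *)
Definition vint A f : R := \sum_(x \in A) (f x * vmeas x).

(* For finite nonempty A this is the maximum. *)
Definition max_on A f : R := sup [set f x | x in A].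

Definition Lap u : G -> R := fun x =>
  (vmeas x)^-1 * \sum_(y \in nbhd x) (weight x y * (u y - u x)).

Definition Gam u v : G -> R := fun x =>
  (2 * vmeas x)^-1 *
    \sum_(y \in nbhd x) (weight x y * (u y - u x) * (v y - v x)).

Definition grad_norm u : G -> R := fun x => Num.sqrt (Gam u u x).

(* m./2 is (m-1)/2 for odd m and m/2 for even m. *)
Definition gradm_norm m u : G -> R := fun x =>
  if odd m then grad_norm (iter m./2 Lap u) x else `|iter m./2 Lap u x|.

Definition Cc Omega : set (G -> R) := [set u | forall x, ~ Omega x -> u x = 0].

Definition Lnorm_on Omega r u : R :=
  vint Omega (fun x => `|u x| `^ r) `^ r^-1.

Definition Linf_on Omega u : R := max_on Omega (fun x => `|u x|).

Definition Wnorm m s Omega u : R :=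
  vint (Omega `|` bdry Omega) (fun x => gradm_norm m u x `^ s) `^ s^-1.

(* Completion of Cc Omega, realized by functions: the pointwise limits of
   Cauchy sequences. As Cc Omega is finite-dimensional, nothing is added. *)
Definition W0 m s Omega : set (G -> R) := [set u | exists u_ : nat -> G -> R,
  [/\ forall n, Cc Omega (u_ n),
      forall e : R, 0 < e -> exists N, forall i j, (N <= i)%N -> (N <= j)%N ->
        Wnorm m s Omega (fun x => u_ i x - u_ j x) < e
    & forall x, u_ n x @[n --> \oo] --> u x]].

Definition embedding_constant m s Omega C :=
  0 < C /\ forall u, W0 m s Omega u ->
    (forall r, 1 <= r -> Lnorm_on Omega r u <= C * Wnorm m s Omega u) /\
    Linf_on Omega u <= C * Wnorm m s Omega u.

(* Where gradm_norm m u vanishes, so does the second factor, so the integrand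
   is 0 there whatever the value of 0 `^ (s - 2). *)
Definition polylap_form m s Omega u phi : R :=
  vint (Omega `|` bdry Omega) (fun x =>
    gradm_norm m u x `^ (s - 2) *
    (if odd m then Gam (iter m./2 Lap u) (iter m./2 Lap phi) x
     else iter m./2 Lap u x * iter m./2 Lap phi x)).

(* f is the function that the (m, s)-poly-Laplacian assigns to u; the values of
   f on Omega are determined by testing against indicators of vertices. *)
Definition is_polylap m s Omega u f :=
  forall phi, Cc Omega phi ->
    vint Omega (fun x => f x * phi x) = polylap_form m s Omega u phi.

Definition is_solution m1 m2 (p q g1 g2 l1 l2 a b : R) Omega
    (h1 h2 c : G -> R) u v :=
  [/\ W0 m1 p Omega u, W0 m2 q Omega v,
      exists2 f, is_polylap m1 p Omega u f & forall x, Omega x ->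
        f x = l1 * h1 x * (`|u x| `^ (g1 - 2) * u x)
              + a / (a + b) * c x * (`|u x| `^ (a - 2) * u x) * `|v x| `^ b,
      exists2 f, is_polylap m2 q Omega v f & forall x, Omega x ->
        f x = l2 * h2 x * (`|v x| `^ (g2 - 2) * v x)
              + b / (a + b) * c x * `|u x| `^ a * (`|v x| `^ (b - 2) * v x)
    & forall x, bdry Omega x -> u x = 0 /\ v x = 0].

End Graph.

(* Main.v *)
Require Import Defs.
From mathcomp Require Import all_boot all_order all_algebra finmap.
From mathcomp Require Import all_classical all_reals all_analysis.
Set Implicit Arguments.
Unset Strict Implicit.
Unset Printing Implicit Defensive.
Import Order.TTheory GRing.Theory Num.Theory.
Import numFieldNormedType.Exports.
Local Open Scope classical_set_scope.
Local Open Scope ring_scope.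

(* Testing the equation for a semi-trivial solution (u, 0) against u itself
   gives ||u||^p = lambda1 int h1 |u|^gamma1 <= lambda1 H1 (C ||u||)^gamma1,
   because the coupling term vanishes; as gamma1 < p, one divides by
   ||u||^gamma1. *)

Section Graph.
Variables (R : realType) (G : wgraph R).
Implicit Types (x y : G) (u f h : G -> R) (A Omega : set G).
Implicit Types (m n : nat) (s g l C : R).

Lemma vmeas_gt0 x : 0 < vmeas x.
Proof. by have [mu0 mu0_gt0 /(_ x)] := vmeas_ge G; exact: lt_le_trans. Qed.

(** Induction on the length bound: a nonempty walk from [x] starts with a step to one of finitely
    many neighbours and continues with a shorter walk. *)
Lemma finite_walk_endpoints n x : locally_finite G ->
  finite_set [set y | exists2 t, (size t <= n)%N &
                        path (@adj _ G) x t /\ last x t = y].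
Proof.
move=> Glf; elim: n x => [|n IHn] x.
  apply: (@sub_finite_set _ _ [set x]); last exact: finite_set1.
  by move=> y [[|//] _ [_ /= <-]].
apply: (@sub_finite_set _ _ ([set x] `|` \bigcup_(z in nbhd x)
    [set y | exists2 t, (size t <= n)%N &
               path (@adj _ G) z t /\ last z t = y])).
  move=> y [[|z t] /= tn [xt yE]]; first by left.
  by case/andP: xt => xz zt; right; exists z => //; exists t.
rewrite finite_setU; split; first exact: finite_set1.
by apply: bigcup_finite => [|z _]; [exact: Glf|exact: IHn].
Qed.

(** A bounded set lies in a ball around any one of its points, and balls are finite by local
    finiteness. This makes every sum and maximum over the domain a genuine finite one. *)
Lemma bounded_domain_finite A :
  locally_finite G -> bounded_domain A -> finite_set A.
Proof.
move=> Glf [D AD]; have [->|/set0P[x Ax]] := eqVneq A set0.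
  exact: finite_set0.
apply: sub_finite_set (finite_walk_endpoints (Num.truncn (D + 1)) x Glf).
(* The slack 1 makes the inequality strict, so the infimum defining [gdist] is undercut by an actual
   walk of length below [D + 1]. *)
move=> y Ay; have : (gdist x y < (D + 1)%:E)%E.
  by apply: le_lt_trans (AD x y Ax Ay) _; rewrite lte_fin ltrDl.
move=> /ereal_inf_lt[_ [t xty <-]]; rewrite lte_fin => tD.
exists t => //; rewrite truncn_ge_nat; first exact: ltW.
exact: le_trans (ltW tD).
Qed.

Lemma le_max_on A f x : finite_set A -> A x -> f x <= max_on A f.
Proof.
move=> A_fin Ax; apply: ub_le_sup; last by exists x.
(* The start value 0 is harmless, even for negative [f]: only some upper bound is wanted here. *)
exists (\big[Num.max/0]_(y <- fset_set A) f y) => _ [y Ay <-].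
by apply: le_bigmax_seq => //; rewrite in_fset_set// inE.
Qed.

Lemma eq_vint A f1 f2 : (forall x, A x -> f1 x = f2 x) ->
  vint A f1 = vint A f2.
Proof. by move=> E; apply: eq_fsbigr => x /set_mem Ax; rewrite E. Qed.

Lemma vint_ge0 A f : (forall x, A x -> 0 <= f x) -> 0 <= vint A f.
Proof.
by move=> f0; apply: fsumr_ge0 => x Ax; rewrite mulr_ge0 ?f0// ltW ?vmeas_gt0.
Qed.

Lemma vintZl A (k : R) f : vint A (fun x => k * f x) = k * vint A f.
Proof.
by rewrite /vint mulr_fsumr; apply: eq_fsbigr => x _; rewrite mulrA.
Qed.

Lemma le_vint A f1 f2 : finite_set A -> (forall x, A x -> f1 x <= f2 x) ->
  vint A f1 <= vint A f2.
Proof.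
move=> A_fin f12; rewrite /vint !fsbig_finite//= big_seq [leRHS]big_seq.
apply: ler_sum => x; rewrite in_fset_set// inE => Ax.
by rewrite ler_wpM2r ?f12// ltW ?vmeas_gt0.
Qed.

Lemma Gam_ge0 u x : 0 <= Gam u u x.
Proof.
rewrite mulr_ge0// ?invr_ge0 ?mulr_ge0 ?(ltW (vmeas_gt0 _))//.
apply: fsumr_ge0 => y xy; rewrite -mulrA -expr2 mulr_ge0 ?sqr_ge0//.
by rewrite ltW// weight_gt0.
Qed.

Lemma gradm_norm_ge0 m u x : 0 <= gradm_norm m u x.
Proof. by rewrite /gradm_norm; case: ifP => _; rewrite ?sqrtr_ge0. Qed.

Lemma gradm_norm_sqr m u x : gradm_norm m u x ^+ 2 =
  if odd m then Gam (iter m./2 (@Lap R G) u) (iter m./2 (@Lap R G) u) x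
  else iter m./2 (@Lap R G) u x * iter m./2 (@Lap R G) u x.
Proof.
rewrite /gradm_norm; case: ifP => _; first by rewrite sqr_sqrtr ?Gam_ge0.
by rewrite real_normK ?num_real.
Qed.

(** At [a = 0] the square annihilates whatever value the first factor has; [s != 0] is what gives
    the right side the value 0, since 0 to the power 0 is 1. *)
Lemma powRB2_sqr (a s : R) : 0 <= a -> s != 0 -> a `^ (s - 2) * a ^+ 2 = a `^ s.
Proof.
move=> a0 s0; have [->|an0] := eqVneq a 0.
  by rewrite expr0n/= mulr0 powR0.
by rewrite -powR_mulrn// -powRD ?subrK// an0 implybT.
Qed.

Lemma powRVK (a s : R) : 0 <= a -> s != 0 -> (a `^ s^-1) `^ s = a.
Proof. by move=> a0 s0; rewrite -powRrM mulVf// powRr1. Qed.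

Lemma Wnorm_powR m s Omega u : s != 0 ->
  Wnorm m s Omega u `^ s = polylap_form m s Omega u u.
Proof.
move=> s0; rewrite powRVK//; last first.
  by apply: vint_ge0 => x _; exact: powR_ge0.
apply: eq_vint => x _.
by rewrite -gradm_norm_sqr powRB2_sqr ?gradm_norm_ge0.
Qed.

(** Outside [Omega] the approximating sequence is constantly 0, hence so is its limit. This allows
    [u] itself as a test function. *)
Lemma W0_Cc m s Omega u : W0 m s Omega u -> Cc Omega u.
Proof.
move=> [u_ [u_Cc _ u_u]] x Ox; have := u_u x.
under eq_fun do rewrite u_Cc//.
by move/(cvg_lim (@Rhausdorff R)); rewrite lim_cst//; exact: Rhausdorff.
Qed.

(** The single equation left once the coupling term is gone; both halves of the theorem are
    instances. *)
Lemma polylap_Wnorm_le m s Omega g l h C u f :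
  finite_set Omega -> Omega !=set0 -> 1 < g -> g < s -> 0 < l ->
  (forall x, Omega x -> 0 < h x) ->
  embedding_constant m s Omega C -> W0 m s Omega u ->
  is_polylap m s Omega u f ->
  (forall x, Omega x -> f x = l * h x * (`|u x| `^ (g - 2) * u x)) ->
  Wnorm m s Omega u <= (l * max_on Omega h * C `^ g) `^ (s - g)^-1.
Proof.
move=> O_fin [x0 Ox0] g1 gs l0 h0 [C0 Cemb] W0u fu fE.
have g_gt0 : 0 < g by exact: lt_trans g1.
have s_gt0 : 0 < s by exact: lt_trans gs.
have sg_gt0 : 0 < s - g by rewrite subr_gt0.
have H0 : 0 <= max_on Omega h.
  by apply: le_trans (le_max_on h O_fin Ox0); rewrite ltW ?h0.
set N := Wnorm m s Omega u.
have N0 : 0 <= N by exact: powR_ge0.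
have intg0 : 0 <= vint Omega (fun x => `|u x| `^ g).
  by apply: vint_ge0 => x _; exact: powR_ge0.
have NsE : N `^ s = l * vint Omega (fun x => h x * `|u x| `^ g).
  rewrite Wnorm_powR ?gt_eqF// -(fu u (W0_Cc W0u)) -vintZl.
  apply: eq_vint => x Ox; rewrite fE// -!mulrA -expr2.
  by rewrite -real_normK ?num_real// powRB2_sqr ?gt_eqF.
(* The embedding inequality with exponent [r = g], raised to the power [g]. *)
have intg_le : vint Omega (fun x => `|u x| `^ g) <= (C * N) `^ g.
  rewrite -[leLHS](powRVK _ (lt0r_neq0 g_gt0))//.
  apply: ge0_ler_powR; rewrite ?nnegrE ?powR_ge0 ?mulr_ge0 ?(ltW g_gt0)//.
    exact: ltW.
  by have [+ _] := Cemb u W0u; apply; exact: ltW.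
have Ns_le : N `^ s <= (l * max_on Omega h * C `^ g) * N `^ g.
  rewrite NsE -!mulrA -powRM ?(ltW C0)// ler_pM2l//.
  apply: le_trans (ler_wpM2l H0 intg_le); rewrite -vintZl.
  by apply: le_vint => // x Ox; rewrite ler_wpM2r ?powR_ge0 ?le_max_on.
(* Dividing by the power [g] of [N] requires [N] nonzero; for [N = 0] the bound is just
   nonnegativity of a power. *)
have [->|Nn0] := eqVneq N 0; first exact: powR_ge0.
have N_gt0 : 0 < N by rewrite lt0r Nn0.
have NB_le : N `^ (s - g) <= l * max_on Omega h * C `^ g.
  rewrite -(ler_pM2r (powR_gt0 g N_gt0)) -powRD ?subrK//.
  by rewrite Nn0 implybT.
(* Extraction of the root of order [s - g], monotone because [s - g] is positive. *)
rewrite -[leLHS](powRr1 N0) -(mulfV (lt0r_neq0 sg_gt0)) powRrM.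
apply: ge0_ler_powR; rewrite ?nnegrE ?powR_ge0 ?invr_ge0 ?(ltW sg_gt0)//.
by rewrite !mulr_ge0 ?powR_ge0 ?(ltW l0).
Qed.

End Graph.

Theorem theorem1p2 (R : realType) (G : wgraph R) (Omega : set G)
    (m1 m2 : nat) (p q gamma1 gamma2 lambda1 lambda2 alpha beta : R)
    (h1 h2 c : G -> R) (C1 C2 : R)
    (Glf : locally_finite G)
    (Omega_bounded : bounded_domain (Omega `|` bdry Omega))
    (Omega_neq0 : Omega !=set0) (bdry_neq0 : bdry Omega !=set0)
    (m1_gt0 : (0 < m1)%N) (m2_gt0 : (0 < m2)%N)
    (p_gt1 : 1 < p) (q_gt1 : 1 < q)
    (gamma1_gt1 : 1 < gamma1) (gamma2_gt1 : 1 < gamma2)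
    (lambda1_gt0 : 0 < lambda1) (lambda2_gt0 : 0 < lambda2)
    (alpha_gt0 : 0 < alpha) (beta_gt0 : 0 < beta)
    (gamma_lt : Num.max gamma1 gamma2 < Num.min p q)
    (alphabeta_gt : Num.max p q < alpha + beta)
    (h1_gt0 : forall x, Omega x -> 0 < h1 x)
    (h2_gt0 : forall x, Omega x -> 0 < h2 x)
    (c_gt0 : forall x, Omega x -> 0 < c x)
    (C1_emb : embedding_constant m1 p Omega C1)
    (C2_emb : embedding_constant m2 q Omega C2) :
  (forall u : G -> R,
    is_solution m1 m2 p q gamma1 gamma2 lambda1 lambda2 alpha beta Omega
      h1 h2 c u (cst 0) ->
    Wnorm m1 p Omega u
      <= (lambda1 * max_on Omega h1 * C1 `^ gamma1) `^ (p - gamma1)^-1) /\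
  (forall v : G -> R,
    is_solution m1 m2 p q gamma1 gamma2 lambda1 lambda2 alpha beta Omega
      h1 h2 c (cst 0) v ->
    Wnorm m2 q Omega v
      <= (lambda2 * max_on Omega h2 * C2 `^ gamma2) `^ (q - gamma2)^-1).
Proof.
move: gamma_lt; rewrite lt_min !gt_max => /andP[/andP[g1p g2p] /andP[g1q g2q]].
have Omega_fin : finite_set Omega.
  apply: (@sub_finite_set _ _ (Omega `|` bdry Omega)); first exact: subsetUl.
  exact: bounded_domain_finite.
split=> [u [W0u _ [f fu fE] _ _]|v [_ W0v _ [f fv fE] _]].
- apply: polylap_Wnorm_le C1_emb W0u fu _ => //.
  (* The coupling term carries the power [beta] of 0, which vanishes because [beta] is positive. *)
  by move=> x Ox; rewrite (fE x Ox) /= normr0 powR0 ?gt_eqF// mulr0 addr0.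
- apply: polylap_Wnorm_le C2_emb W0v fv _ => //.
  (* Here the vanishing factor is the power [alpha] of 0, with [alpha] positive. *)
  by move=> x Ox; rewrite (fE x Ox) /= normr0 powR0 ?gt_eqF// mulr0 mul0r addr0.
Qed.
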